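(* Let $\{X(k)\}_{k\geqslant 1}$ be the family of graphs defined in the context, and let $P_k(q) = P_{X(k)}(q)$ be the chromatic polynomial of $X(k)$. Then for all $k \geqslant 1$, \[ P_{k+3}(q) = A(q)\,(q-2)\, P_{k+2}(q) + B(q)\,(q-2)^2\, P_{k+1}(q) + C(q)\,(q-2)^3\, P_k(q), \] where \begin{align*} A(q) &= q^5-9 q^4+37 q^3-88 q^2+127 q-94, \\ B(q) &= 6 q^7-81 q^6+497 q^5-1781 q^4+4026 q^3-5780 q^2+4968 q-2024, \\ C(q) &= (q-1)^2 \left(3 q^2-15 q+25\right)\left(3 q^5-33 q^4+157 q^3-399 q^2+535 q-299\right), \end{align*} and the base cases for this recurrence are \begin{align*} P_1(q) &= q (q-1)^2 (q-2) \left( q^3-7 q^2+19 q-19 \right),\\ P_2(q) &= q (q-1) (q-2)^2 \bigl(q^9-17 q^8+138 q^7-692 q^6 + 2353 q^5-5630 q^4+9525 q^3\\ &\qquad -11086 q^2+8152 q-2913\bigr),\\ P_3(q) &= q (q-1) (q-2)^3 \bigl(q^{14}-26 q^{13}+328 q^{12}-2645 q^{11}+ 15181 q^{10} -65498 q^9 +219032 q^8\\ &\qquad -577468 q^7 +1209533 q^6-2011958 q^5 +2633017 q^4 -2650178 q^3\\ &\qquad +1957169 q^2-957460 q+235366 \bigr). \end{align*}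
   Context: For a finite simple graph $G$, the chromatic polynomial $P_G$ is the unique polynomial such that $P_G(q)$ equals the number of proper $q$-colourings of $G$ for every non-negative integer $q$. The graph $X(k)$ ($k\geqslant 1$) is obtained from the $k$-spoke wheel by replacing each of the $k$ rim vertices (each of degree $3$) with a copy of $K_{3,3}$ as follows: the vertex is replaced by a triangle (each of the three edges formerly at the vertex being attached to a different triangle vertex), then each edge of the triangle is subdivided once, and each subdividing vertex is joined to the one triangle vertex to which it is not already adjacent. (The $1$-spoke wheel is a single edge with a loop at one end, that end being the rim vertex; the $2$-spoke wheel is a $3$-vertex path with a double edge added between its two end-vertices, those being the rim vertices.) Explicitly, $X(k)$ is the simple graph on $6k+1$ vertices: a hub vertex $h$ and, for each $i \in \mathbb{Z}/k\mathbb{Z}$, six vertices $l_i, m_i, r_i, a_i, b_i, c_i$. Its edges are: for each $i$, all nine edges between $\{l_i,m_i,r_i\}$ and $\{a_i,b_i,c_i\}$; for each $i$, the edge $h m_i$; and for each $i$, the edge $r_i l_{i+1}$, with indices modulo $k$ (so for $k=1$ this is the edge $r_0 l_0$). *)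

(* Defs.v *)
From HB Require Import structures.
From mathcomp Require Import all_boot all_order all_algebra.

Set Implicit Arguments.
Unset Strict Implicit.
Unset Printing Implicit Defensive.

Import Order.TTheory GRing.Theory Num.Theory.
Local Open Scope ring_scope.

Record sgraph := SGraph {
  vertex :> finType;
  adj : rel vertex;
  adj_sym : symmetric adj;
  adj_irrefl : irreflexive adj }.

Definition proper_colouring (G : sgraph) (q : nat) (f : {ffun G -> 'I_q}) :
    bool :=
  [forall x, forall y, adj x y ==> (f x != f y)].

Definition num_colourings (G : sgraph) (q : nat) : nat :=
  #|[set f : {ffun G -> 'I_q} | proper_colouring f]|.

Definition is_chromatic_poly (G : sgraph) (p : {poly int}) : Prop :=
  forall q : nat, p.[q%:R] = (num_colourings G q)%:R.

Lemma card_constant_colourings (T : finType) (E : seq (T * T)) (q : nat)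
    (e : rel T := fun x y => ((x, y) \in E) || ((y, x) \in E)) :
  #|[set f : {ffun T -> 'I_q} | all (fun u => f u.1 == f u.2) E]|
    = (q ^ #|[pred x | roots e x]|)%N.
Proof.
have symE : connect_sym e.
  by apply: sym_connect_sym => x y; rewrite /e orbC.
pose R := {x : T | roots e x}.
pose rt x : R := Sub (fingraph.root e x) (roots_root symE x).
pose ext (h : {ffun R -> 'I_q}) := [ffun x : T => h (rt x)].
have ext_inj : injective ext.
  move=> h1 h2 /ffunP eq_h; apply/ffunP => r.
  have rtK : rt (val r) = r by apply: val_inj; apply/eqP: (valP r).
  by have := eq_h (val r); rewrite !ffunE rtK.
have -> : (q ^ #|[pred x | roots e x]| = #|{ffun R -> 'I_q}|)%N.
  by rewrite card_ffun card_ord card_sig.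
rewrite -cardsT -(card_imset _ ext_inj); apply: eq_card => f; rewrite inE.
apply/allP/imsetP => [fE | [h _ ->] u uE]; last first.
  rewrite !ffunE; apply/eqP; congr (h _); apply: val_inj => /=.
  by apply/(fingraph.rootP symE)/connect1; rewrite /e -surjective_pairing uE.
exists [ffun r : R => f (val r)] => //; apply/ffunP => x; rewrite !ffunE /=.
have /connectP[p pP ->] := connect_root e x.
elim: p x pP => //= z p IHp y /andP[eyz pz]; rewrite -IHp //.
by case/orP: eyz => /fE /= /eqP ->.
Qed.

(* Deletion-contraction: E lists the pairs that must be given equal colours,  *)
(* s those that must be given different colours.                              *)
Lemma colouring_count_poly (T : finType) (s E : seq (T * T)) :
  {p : {poly int} | forall q : nat, p.[q%:R] =
     #|[set f : {ffun T -> 'I_q} | all (fun u => f u.1 == f u.2) E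
                                 & all (fun u => f u.1 != f u.2) s]|%:R}.
Proof.
elim: s E => [|u s IHs] E.
  pose e : rel T := fun x y => ((x, y) \in E) || ((y, x) \in E).
  exists 'X^#|[pred x | roots e x]| => q.
  rewrite hornerXn -natrX -card_constant_colourings.
  by congr (_%:R); apply: eq_card => f; rewrite !inE andbT.
have [p1 p1E] := IHs E; have [p2 p2E] := IHs (u :: E).
exists (p1 - p2) => q; rewrite hornerD hornerN p1E p2E.
apply/eqP; rewrite subr_eq -natrD; apply/eqP; congr (_%:R).
rewrite -(cardsID [set f : {ffun T -> 'I_q} | f u.1 == f u.2]) addnC.
by congr (_ + _)%N; apply: eq_card => f; rewrite !inE /=;
   case: (f u.1 == f u.2); rewrite /= ?andbF ?andbT.
Qed.

Lemma chromatic_poly_exists (G : sgraph) :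
  {p : {poly int} | is_chromatic_poly G p}.
Proof.
have [p pE] := colouring_count_poly [seq u <- enum {: G * G} | adj u.1 u.2] [::].
exists p => q; rewrite pE; congr (_%:R); apply: eq_card => f; rewrite !inE /=.
apply/allP/forallP => [fP x | fP [x y]].
  apply/forallP => y; apply/implyP => xy.
  by apply: (fP (x, y)); rewrite mem_filter /= xy mem_enum.
by rewrite mem_filter => /andP[/= xy _]; have /forallP/(_ y)/implyP := fP x; apply.
Qed.

Lemma chromatic_poly_unique (G : sgraph) (p1 p2 : {poly int}) :
  is_chromatic_poly G p1 -> is_chromatic_poly G p2 -> p1 = p2.
Proof.
move=> p1P p2P; apply/eqP; rewrite -subr_eq0; apply/eqP.
pose n := size (p1 - p2).
apply: (@roots_geq_poly_eq0 _ _ [seq i%:R | i <- iota 0 n]).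
- apply/allP => _ /mapP[i _ ->]; apply/rootP.
  by rewrite hornerD hornerN p1P p2P subrr.
- by rewrite map_inj_uniq ?iota_uniq //; apply: mulrIn.
- by rewrite size_map size_iota.
Qed.

Definition chromatic_poly (G : sgraph) : {poly int} :=
  sval (chromatic_poly_exists G).

Lemma chromatic_polyP (G : sgraph) : is_chromatic_poly G (chromatic_poly G).
Proof. exact: svalP (chromatic_poly_exists G). Qed.

Section WheelOfK33.

Variable k : nat.

(* None is the hub; Some (i, inl 0), Some (i, inl 1), Some (i, inl 2) are     *)
(* l_i, m_i, r_i, and Some (i, inr j), j < 3, are a_i, b_i, c_i.              *)
Definition X_vertex : finType := option ('I_k * ('I_3 + 'I_3)).

Definition X_hub : X_vertex := None.
Definition X_l (i : 'I_k) : X_vertex := Some (i, inl (inord 0)).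
Definition X_m (i : 'I_k) : X_vertex := Some (i, inl (inord 1)).
Definition X_r (i : 'I_k) : X_vertex := Some (i, inl (inord 2)).

(* Each edge is listed in one orientation; ordS is the successor modulo k.    *)
Definition X_arc (x y : X_vertex) : bool :=
  [|| [exists i, exists a, exists b,
         (x == Some (i, inl a)) && (y == Some (i, inr b))],
      [exists i, (x == X_hub) && (y == X_m i)]
    | [exists i, (x == X_r i) && (y == X_l (ordS i))]].

Definition X_adj : rel X_vertex := [rel x y | X_arc x y || X_arc y x].

Lemma X_adj_sym : symmetric X_adj.
Proof. by move=> x y; exact: orbC. Qed.

Lemma X_adj_irrefl : irreflexive X_adj.
Proof.
move=> x; rewrite /X_adj /= orbb; apply/negP; case/or3P.
- by case/existsP=> i /existsP[a /existsP[b /andP[/eqP-> /eqP]]].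
- by case/existsP=> i /andP[/eqP-> /eqP].
- case/existsP=> i /andP[/eqP-> /eqP[_ /(congr1 val)]].
  by rewrite /= !inordK.
Qed.

Definition X_graph : sgraph := SGraph X_adj_sym X_adj_irrefl.

End WheelOfK33.

(* Main.v *)
Require Import Defs.
From mathcomp Require Import all_boot all_order all_algebra.
From mathcomp Require Import ring.

Set Implicit Arguments.
Unset Strict Implicit.
Unset Printing Implicit Defensive.

Import Order.TTheory GRing.Theory Num.Theory.
Local Open Scope ring_scope.

(** The proof is a transfer-matrix computation.  Fix the colour [h] of the hub,
    out of [q] colours.  A copy of $K_{3,3}$ sees the rest of the graph only
    through its vertices [l], [m] and [r], so the colourings extending [h] are
    the closed walks of length [k] on the colours of the vertices $l_i$, where
    the weight [W x y] of a step counts the colourings of one copy whose [l] has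
    colour [x], whose [m] avoids [h] and whose [r] avoids [y].  Their number is
    the trace of [W ^+ k] ([num_colourings_trace]).

    The colours other than [h] are interchangeable, so [W] is invariant under
    their permutations: it equals [lam%:M + V *m K *m V^T] where the two columns
    of [V] are the indicator of [h] and the all-ones vector ([block_weightE]).
    Hence [W] has the eigenvalue [lam] with multiplicity [q - 2], on the vectors
    that vanish at [h] and have sum zero, together with the two eigenvalues of
    the 2 x 2 matrix [M = lam%:M + K *m (V^T *m V)].  In this division-free
    setting the corresponding trace identity is [mxtrace_rank_update].

    Summing over [h] gives $P_k = q (\mathrm{tr} M^k + (q-2) lam^k)$ at every
    natural number [q], hence as polynomials ([chromatic_poly_wheelE]).  Such a
    combination of [k]-th powers satisfies the recurrence whose characteristic
    polynomial is [(z - lam) * (z^2 - tr M * z + det M)]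
    ([wheel_poly_recurrence]); expanding its coefficients yields the [A], [B] and
    [C] of the theorem, and expanding the first three traces yields the base
    cases. *)

(** * Traces of powers *)

(** Over a field this is Sylvester's identity: [V *m N] and [N *m V] have the
    same nonzero eigenvalues.  Both powers are controlled by one matrix [Q],
    which makes the identity hold over any commutative ring. *)
Lemma mxtrace_rank_update (R : comNzRingType) n m (d : R)
    (V : 'M[R]_(n, m)) (N : 'M[R]_(m, n)) k :
  \tr ((d%:M + V *m N) ^+ k) - n%:R * d ^+ k
  = \tr ((d%:M + N *m V) ^+ k) - m%:R * d ^+ k.
Proof.
suff [Q [-> ->]] : exists Q : 'M_m,
    (d%:M + V *m N) ^+ k = (d ^+ k)%:M + V *m Q *m N
    /\ (d%:M + N *m V) ^+ k = (d ^+ k)%:M + Q *m (N *m V).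
  rewrite !mxtraceD !mxtrace_scalar -!(mulr_natl (d ^+ k)) addrAC subrr add0r.
  by rewrite addrAC subrr add0r mxtrace_mulC !mulmxA mxtrace_mulC !mulmxA.
elim: k => [|k [Q [IH1 IH2]]].
  by exists 0; rewrite !expr0 mulmx0 !mul0mx !addr0.
exists (d *: Q + (d ^+ k)%:M + N *m V *m Q); split.
  rewrite !exprS IH1 -mulmxE mulmxDl !mulmxDr -scalar_mxM.
  rewrite !mul_scalar_mx !mulmxDl !mul_mx_scalar -!scalemxAr -!scalemxAl.
  by rewrite !mulmxA !addrA.
rewrite !exprS IH2 -mulmxE mulmxDl !mulmxDr -scalar_mxM.
rewrite !mul_scalar_mx !mul_mx_scalar !mulmxDl !mulmxA -!scalemxAl.
by rewrite mul_scalar_mx -scalemxAl !addrA.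
Qed.

Lemma sum_tuple_cons (T : finType) (V : nmodType) n (F : n.+1.-tuple T -> V) :
  \sum_t F t = \sum_x \sum_(t : n.-tuple T) F [tuple of x :: t].
Proof.
rewrite pair_bigA.
rewrite (reindex (fun p : T * n.-tuple T => [tuple of p.1 :: p.2])) //=.
exists (fun t => (thead t, [tuple of behead t])) => [[x t] _ | t _].
  by congr (_, _); apply: val_inj.
by rewrite -tuple_eta.
Qed.

(** The tuple [t] lists the inner vertices of a walk from [x] to [y]. *)
Lemma sum_walks (R : comNzRingType) (q n : nat) (W : 'M[R]_q) (x y : 'I_q) :
  \sum_(t : n.-tuple 'I_q)
     \prod_(i < n.+1) W (nth x (x :: t) i) (nth x (rcons t y) i)
  = (W ^+ n.+1) x y.
Proof.
elim: n x => [|n IH] x.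
  rewrite (big_pred1 [tuple]) => [|t]; first by rewrite big_ord1 expr1.
  by apply/esym/eqP/val_inj; case: t => -[].
rewrite sum_tuple_cons exprS -mulmxE mxE; apply: eq_bigr => z _.
rewrite -IH mulr_sumr; apply: eq_bigr => t _.
rewrite big_ord_recl /=; congr (_ * _); apply: eq_bigr => i _.
rewrite add0n; congr (fun_of_matrix W _ _); apply: set_nth_default;
  by rewrite /= ?size_rcons size_tuple.
Qed.

(** There is no version of length 0: the left-hand side would be 1, the
    right-hand side [q]. *)
Lemma sum_closed_walks (R : comNzRingType) (q n : nat) (W : 'M[R]_q) :
  \sum_(f : {ffun 'I_n.+1 -> 'I_q}) \prod_i W (f i) (f (ordS i))
  = \tr (W ^+ n.+1).
Proof.
rewrite (reindex (fun t : n.+1.-tuple 'I_q => [ffun i => tnth t i])) /=;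
  last first.
  exists (fun f => [tuple f i | i < n.+1]) => [t _ | f _].
    by apply: eq_from_tnth => i; rewrite tnth_mktuple ffunE.
  by apply/ffunP => i; rewrite ffunE tnth_mktuple.
rewrite sum_tuple_cons; apply: eq_bigr => x _.
rewrite -sum_walks; apply: eq_bigr => t _; apply: eq_bigr => i _.
rewrite !ffunE !(tnth_nth x) /=; congr (W _ _).
have := ltn_ord i; rewrite ltnS leq_eqVlt => /predU1P[-> | lt_in].
  by rewrite modnn nth_rcons size_tuple ltnn eqxx.
by rewrite modn_small //= nth_rcons size_tuple lt_in.
Qed.

(** * The closed formula and its recurrence *)

Section WheelPolynomial.

Variables (R : comNzRingType) (q : R).

(** The number of ways of colouring [a], [b] and [c] when [l], [m] and [r] use
    [j] different colours. *)
Definition avoid_cube (j : nat) : R := (q - j%:R) ^+ 3.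

(** By how much the count exceeds [avoid_cube 3] for each coincidence among the
    colours of [l], [m], [r], and the correction when all three coincide; see
    [core_weightE]. *)
Definition pair_gain : R := avoid_cube 2 - avoid_cube 3.
Definition triple_gain : R :=
  avoid_cube 1 - 3%:R * avoid_cube 2 + 2%:R * avoid_cube 3.

(** The coefficient of the identity in the transfer matrix, which is its
    eigenvalue of multiplicity [q - 2]. *)
Definition lam : R := - (q - 1) * pair_gain - triple_gain.

(** The entry [W x y] of the transfer matrix when [x], [y] and the colour of the
    hub are distinct. *)
Definition generic_weight : R :=
  (q - 1) ^+ 2 * avoid_cube 3 + (3%:R * q - 4%:R) * pair_gain + triple_gain.

(** The matrix [K] such that [W = lam%:M + V *m K *m V^T], and the Gram matrix
    [V^T *m V], for [V] with columns the indicator of the hub colour and the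
    all-ones vector. *)
Definition hub_form : 'M[R]_(1 + 1) :=
  block_mx triple_gain%:M lam%:M pair_gain%:M generic_weight%:M.
Definition hub_gram : 'M[R]_(1 + 1) := block_mx 1%:M 1%:M 1%:M q%:M.

Definition quotient_mx : 'M[R]_(1 + 1) := lam%:M + hub_form *m hub_gram.

Definition quotient_tr : R :=
  triple_gain + lam + pair_gain + generic_weight * q + 2%:R * lam.
Definition quotient_det : R :=
  (triple_gain + lam + lam) * (pair_gain + generic_weight * q + lam)
  - (triple_gain + lam * q) * (pair_gain + generic_weight).

Lemma quotient_mxE :
  quotient_mx = block_mx (triple_gain + lam + lam)%:M
                         (triple_gain + lam * q)%:M
                         (pair_gain + generic_weight)%:M
                         (pair_gain + generic_weight * q + lam)%:M.
Proof.
rewrite /quotient_mx mulmx_block -!scalar_mxM !mulr1 -!raddfD /=.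
rewrite scalar_mx_block add_block_mx -!raddfD /= !add0r.
by rewrite ![lam + _]addrC.
Qed.

Lemma mxtrace_quotient_mx : \tr quotient_mx = quotient_tr.
Proof. by rewrite quotient_mxE mxtrace_block !mxtrace_scalar /quotient_tr; ring. Qed.

Lemma quotient_mx_sqr :
  quotient_mx ^+ 2 = quotient_tr *: quotient_mx - quotient_det%:M.
Proof.
rewrite quotient_mxE expr2 -mulmxE mulmx_block -!scalar_mxM -!raddfD /=.
rewrite scalar_mx_block scale_block_mx opp_block_mx add_block_mx.
rewrite !scale_scalar_mx -!raddfN -!raddfD /= !oppr0 !addr0.
by congr block_mx; congr (_%:M); rewrite /quotient_tr /quotient_det; ring.
Qed.

Lemma mxtrace_quotient_mxSS k :
  \tr (quotient_mx ^+ k.+2)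
  = quotient_tr * \tr (quotient_mx ^+ k.+1)
    - quotient_det * \tr (quotient_mx ^+ k).
Proof.
rewrite -addn2 exprD quotient_mx_sqr mulrBr -scalerAr -exprSr mxtraceD mxtraceZ.
by rewrite raddfN /= -mulmxE mul_mx_scalar mxtraceZ.
Qed.

Definition wheel_poly (k : nat) : R :=
  q * (\tr (quotient_mx ^+ k) + (q - 2%:R) * lam ^+ k).

(** The coefficients are those of
    [(z - lam) * (z^2 - quotient_tr * z + quotient_det)]. *)
Lemma wheel_poly_recurrence k :
  wheel_poly k.+3 = (quotient_tr + lam) * wheel_poly k.+2
                    - (quotient_det + quotient_tr * lam) * wheel_poly k.+1
                    + quotient_det * lam * wheel_poly k.
Proof. by rewrite /wheel_poly !mxtrace_quotient_mxSS !exprS; ring. Qed.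

End WheelPolynomial.

Lemma rmorph_wheel_poly (R S : comNzRingType) (f : {rmorphism R -> S}) q k :
  f (wheel_poly q k) = wheel_poly (f q) k.
Proof.
have fcube j : f (avoid_cube q j) = avoid_cube (f q) j.
  by rewrite /avoid_cube rmorphXn rmorphB rmorph_nat.
have fpair : f (pair_gain q) = pair_gain (f q).
  by rewrite /pair_gain rmorphB !fcube.
(* Naming the factors keeps [rmorphM] from unfolding the cubes. *)
have ftriple : f (triple_gain q) = triple_gain (f q).
  rewrite /triple_gain rmorphD rmorphB fcube (rmorphM f 3%:R) (rmorphM f 2%:R).
  by rewrite !fcube !rmorph_nat.
have flam : f (lam q) = lam (f q).
  by rewrite /lam rmorphB rmorphM rmorphN rmorphB rmorph1 fpair ftriple.
have fgen : f (generic_weight q) = generic_weight (f q).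
  rewrite /generic_weight rmorphD ftriple rmorphD.
  rewrite (rmorphM f ((q - 1) ^+ 2)) (rmorphM f (3%:R * q - 4%:R)) fcube fpair.
  by rewrite rmorphXn !rmorphB rmorph1 rmorphM !rmorph_nat.
have fM : map_mx f (quotient_mx q) = quotient_mx (f q).
  rewrite !quotient_mxE map_block_mx !map_scalar_mx.
  congr block_mx; congr (_%:M) => /=.
  - by rewrite rmorphD rmorphD ftriple flam.
  - by rewrite rmorphD (rmorphM f (lam q)) ftriple flam.
  - by rewrite rmorphD fpair fgen.
  - by rewrite rmorphD rmorphD (rmorphM f (generic_weight q)) fpair fgen flam.
rewrite /wheel_poly rmorphM rmorphD (rmorphM f (q - 2%:R)) rmorphB rmorph_nat.
by rewrite rmorphXn flam; congr (_ * (_ + _)); rewrite -fM -trace_map_mx rmorphXn.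
Qed.

(** * From colourings to a transfer matrix *)

(** The colours of [l], [m] and [r], and those of [a], [b] and [c]. *)
Definition block_colouring (q : nat) : finType :=
  ('I_q * 'I_q * 'I_q * {ffun 'I_3 -> 'I_q})%type.

Definition left_colour q (s : block_colouring q) := s.1.1.1.
Definition right_colour q (s : block_colouring q) := s.1.2.

Definition assemble k q (p : 'I_q * {ffun 'I_k -> block_colouring q}) :
    {ffun X_vertex k -> 'I_q} :=
  [ffun v : X_vertex k => match v with
   | None => p.1
   | Some (i, inl j) => let: (l, m, r, _) := p.2 i in nth r [:: l; m] j
   | Some (i, inr j) => (p.2 i).2 j
   end].

Lemma assemble_bij k q : bijective (@assemble k q).
Proof.
exists (fun f : {ffun X_vertex k -> 'I_q} =>
    (f (X_hub k), [ffun i => (f (X_l i), f (X_m i), f (X_r i),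
                              [ffun j => f (Some (i, inr j))])])) => [[h s] | f].
  rewrite !ffunE /=; congr (_, _); apply/ffunP => i; rewrite !ffunE /= !inordK //.
  have -> : [ffun j => assemble (h, s) (Some (i, inr j))] = (s i).2.
    by apply/ffunP => j; rewrite !ffunE.
  by case: (s i) => [[[l m] r] t].
apply/ffunP => -[[i [j|j]]|]; rewrite !ffunE //= ?ffunE //.
by case: j => -[|[|[|]]] //= ltj; congr (f (Some (i, inl _))); apply: val_inj;
   rewrite /= inordK.
Qed.

Definition block_proper q (h : 'I_q) (s : block_colouring q) : bool :=
  let: (l, m, r, t) := s in (m != h) && [forall j, t j \notin [:: l; m; r]].

Lemma proper_assemble k q (h : 'I_q) (s : {ffun 'I_k -> block_colouring q}) :
  @proper_colouring (X_graph k) q (assemble (h, s))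
  = [forall i, block_proper h (s i)
               && (right_colour (s i) != left_colour (s (ordS i)))].
Proof.
transitivity [forall x, forall y,
    X_arc x y ==> (assemble (h, s) x != assemble (h, s) y)].
  apply/'forall_'forall_implyP/'forall_'forall_implyP => [P x y xy | P x y].
    by apply: P; rewrite /= /X_adj /= xy.
  by case/orP => /P //; rewrite eq_sym.
apply/'forall_'forall_implyP/forallP => [P i | P x y].
  have Pm : assemble (h, s) (X_hub k) != assemble (h, s) (X_m i).
    by apply: P; apply/or3P/Or32/existsP; exists i; rewrite !eqxx.
  have Pr : assemble (h, s) (X_r i) != assemble (h, s) (X_l (ordS i)).
    by apply: P; apply/or3P/Or33/existsP; exists i; rewrite !eqxx.
  have Pa a b : assemble (h, s) (Some (i, inl a))
                != assemble (h, s) (Some (i, inr b)).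
    apply: P; apply/or3P/Or31/existsP; exists i; apply/existsP; exists a.
    by apply/existsP; exists b; rewrite !eqxx.
  move: Pm Pr; rewrite !ffunE /= !inordK //.
  have {P}Pa a b : (a < 3)%N ->
      nth (right_colour (s i)) [:: left_colour (s i); (s i).1.1.2] a
      != (s i).2 b.
    move=> lta; have := Pa (inord a) b.
    by rewrite !ffunE /= /right_colour /left_colour inordK //; case: (s i) => [[[]]].
  rewrite /block_proper /left_colour /right_colour in Pa *.
  case: (s i) Pa => [[[l m] r] t] /= Pa.
  move=> Pm Pr; apply/andP; split; last by case: (s (ordS i)) Pr => [[[]]].
  rewrite eq_sym Pm /=; apply/forallP => j.
  by rewrite !inE ![t j == _]eq_sym !negb_or (Pa 0) ?(Pa 1) ?(Pa 2).
case/or3P => [/existsP[i /existsP[a /existsP[b /andP[/eqP-> /eqP->]]]]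
             |/existsP[i /andP[/eqP-> /eqP->]] |/existsP[i /andP[/eqP-> /eqP->]]].
- have := P i; rewrite !ffunE /block_proper /=; case: (s i) => [[[l m] r] t] /=.
  case/andP => /andP[_ /forallP/(_ b)].
  rewrite !inE !negb_or ![t b == _]eq_sym => /and3P[tl tm tr] _.
  by case: a => -[|[|[|]]].
- have := P i; rewrite !ffunE /block_proper /= inordK //.
  by case: (s i) => [[[l m] r] t] /=; rewrite eq_sym => /andP[/andP[]].
have := P i; rewrite !ffunE /block_proper /left_colour /right_colour /= !inordK //.
by case: (s i) => [[[l m] r] t]; case: (s _) => [[[l' m'] r'] t'] /= /andP[].
Qed.

Section TransferMatrix.

Variable q : nat.

Local Notation qi := (q%:R : int).
Local Notation cube := (@avoid_cube int q%:R).
Local Notation pair := (@pair_gain int q%:R).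
Local Notation triple := (@triple_gain int q%:R).
Local Notation lam := (@lam int q%:R).
Local Notation generic := (@generic_weight int q%:R).

Definition block_weight (h x y : 'I_q) : int :=
  \sum_(s : block_colouring q | left_colour s == x)
     (block_proper h s && (right_colour s != y))%:R.

Lemma natr_forall (T : finType) (P : pred T) :
  [forall i, P i]%:R = \prod_i (P i)%:R :> int.
Proof.
case: forallP => [P1 | /forallP]; first by rewrite big1 // => i _; rewrite P1.
by rewrite negb_forall => /existsP[i /negbTE Pi]; rewrite (bigD1 i) //= Pi mul0r.
Qed.

(** Grouping the colourings by the colours of the vertices $l_i$ makes the
    choices in different copies of $K_{3,3}$ independent. *)
Lemma num_colourings_trace k :
  (num_colourings (X_graph k.+1) q)%:R
  = \sum_(h < q) \tr ((\matrix_(x, y) block_weight h x y) ^+ k.+1).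
Proof.
rewrite /num_colourings cardsE -sum1_card natr_sum big_mkcond /=.
rewrite (reindex (@assemble k.+1 q)) /=; last exact/onW_bij/assemble_bij.
rewrite -(pair_bigA _ (fun h s =>
  if assemble (h, s) \in [pred f | @proper_colouring (X_graph k.+1) q f]
  then 1 else 0)) /=.
apply: eq_bigr => h _; rewrite -sum_closed_walks.
rewrite (partition_big (fun s : {ffun 'I_k.+1 -> block_colouring q} =>
                          [ffun i => left_colour (s i)]) predT) //=.
apply: eq_bigr => f _.
under [RHS]eq_bigr => i _ do rewrite mxE.
rewrite [RHS]bigA_distr_big_dep; apply: eq_big => [s | s /eqP <-].
  apply/eqP/familyP => [<- i | fP]; first by rewrite ffunE; exact: eqxx.
  by apply/ffunP => i; rewrite ffunE; apply/eqP; exact: fP.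
rewrite inE proper_assemble -mulrb natr_forall.
by apply: eq_bigr => i _; rewrite ffunE.
Qed.

(** * The entries of the transfer matrix *)

Lemma sum_notin (s : seq 'I_q) :
  \sum_a (a \notin s)%:R = q%:R - (size (undup s))%:R :> int.
Proof.
have <- : #|s| = size (undup s).
  by rewrite -(card_uniqP (undup_uniq s)); apply: eq_card => a; rewrite mem_undup.
have -> : \sum_a (a \notin s)%:R = #|[predC s]|%:R :> int.
  rewrite -sum1_card natr_sum [RHS]big_mkcond /=.
  by apply: eq_bigr => a _; rewrite !inE; case: (a \in s).
have /(congr1 (fun n => n%:R : int)) := cardC (mem s).
by rewrite card_ord natrD addrC => /(canRL (addrK _)).
Qed.

Lemma sum_except (F : 'I_q -> int) y :
  \sum_(z | z != y) F z = \sum_z F z - F y.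
Proof. by rewrite [in RHS](bigD1 y) //= [F y + _]addrC addrK. Qed.

Lemma sum_eql (x : 'I_q) : \sum_z (z == x)%:R = 1 :> int.
Proof. by rewrite (bigD1 x) //= eqxx big1 ?addr0 // => z /negbTE->. Qed.

Lemma sum_eqr (x : 'I_q) : \sum_z (x == z)%:R = 1 :> int.
Proof. by under eq_bigr => z _ do rewrite eq_sym; exact: sum_eql. Qed.

Lemma sum_cst (c : int) : \sum_(z < q) c = q%:R * c.
Proof. by rewrite sumr_const card_ord mulr_natl. Qed.

(** The number of ways of colouring [a], [b] and [c], given the colours of [l],
    [m] and [r]. *)
Definition core_weight (x m z : 'I_q) : int :=
  (\sum_a (a \notin [:: x; m; z])%:R) ^+ 3.

(** Writing the count as a polynomial in equality indicators lets the sums over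
    the colours of [m] and [r] be carried out term by term. *)
Lemma core_weightE x m z :
  core_weight x m z
  = cube 3 + pair * ((x == m)%:R + (m == z)%:R + (x == z)%:R)
    + triple * ((x == m)%:R * (x == z)%:R).
Proof.
rewrite /core_weight sum_notin /= !inE /triple_gain /pair_gain /avoid_cube.
case: (eqVneq x m) => [->|xm]; case: (eqVneq m z) => [<-|mz];
  rewrite ?eqxx ?(negbTE xm) ?(negbTE mz) /=; try ring.
by case: (eqVneq x z) => _ /=; ring.
Qed.

Lemma sum_core_weight x m y :
  \sum_(z | z != y) core_weight x m z
  = (qi - 1) * cube 3 + 2%:R * pair + (qi * pair + triple) * (x == m)%:R
    - pair * ((x == m)%:R + (m == y)%:R + (x == y)%:R)
    - triple * ((x == m)%:R * (x == y)%:R).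
Proof.
rewrite sum_except core_weightE; under eq_bigr => z _ do rewrite core_weightE.
(* Generalizing keeps the rewrites below from unfolding the cubes. *)
move: (cube 3) pair triple => p s a.
by rewrite !big_split /= -!mulr_sumr !big_split /= !sum_eqr !sum_cst; ring.
Qed.

Lemma block_weight_core h x y :
  block_weight h x y = \sum_(m | m != h) \sum_(z | z != y) core_weight x m z.
Proof.
rewrite /block_weight
  (reindex_onto (fun p : 'I_q * 'I_q * {ffun 'I_3 -> 'I_q} =>
                   (x, p.1.1, p.1.2, p.2))
                (fun s => (s.1.1.2, s.1.2, s.2))) /=;
  last by case=> [[[l m] z] t] /eqP <-.
transitivity (\sum_m \sum_z \sum_(t : {ffun 'I_3 -> 'I_q})
                 (block_proper h (x, m, z, t) && (z != y))%:R : int).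
  rewrite pair_bigA pair_bigA /=; apply: eq_big => [[[m z] t]|[[m z] t] _] //=.
  by rewrite /left_colour /= !eqxx.
rewrite [RHS]big_mkcond; apply: eq_bigr => m _.
have [->|mh] := eqVneq m h.
  by rewrite big1 // => z _; rewrite big1 // => t _; rewrite /= eqxx.
rewrite [RHS]big_mkcond; apply: eq_bigr => z _ /=.
have [->|zy] := eqVneq z y; first by rewrite big1 // => t _; rewrite andbF.
rewrite /core_weight -[X in _ ^+ X](card_ord 3) -prodr_const bigA_distr_bigA /=.
by apply: eq_bigr => t _; rewrite mh andbT natr_forall.
Qed.

Lemma block_weightE h x y :
  block_weight h x y
  = lam * (x == y)%:R + triple * ((x == h)%:R * (y == h)%:R)
    + lam * (x == h)%:R + pair * (y == h)%:R + generic.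
Proof.
rewrite block_weight_core; under eq_bigr => m _ do rewrite sum_core_weight.
rewrite /generic_weight /lam.
move: (cube 3) pair triple => p s a.
rewrite sum_except !big_split /= !sumrN -!mulr_sumr !big_split /= -!mulr_suml.
rewrite !sum_eqr !sum_eql !sum_cst [h == y]eq_sym.
have -> : (x == h)%:R * (x == y)%:R = (x == h)%:R * (y == h)%:R :> int.
  by have [->|] := eqVneq x h; rewrite ?mul0r // [h == y]eq_sym.
by ring.
Qed.

Lemma mxtrace_block_weight h k :
  \tr ((\matrix_(x, y) block_weight h x y) ^+ k)
  = \tr (quotient_mx qi ^+ k) + (qi - 2%:R) * lam ^+ k.
Proof.
pose V : 'M[int]_(q, 1 + 1) := row_mx (\col_x (x == h)%:R) (const_mx 1).
have -> : \matrix_(x, y) block_weight h x y = lam%:M + V *m (hub_form qi *m V^T).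
  apply/matrixP => x y; rewrite /V /hub_form tr_row_mx mul_block_col mul_row_col.
  rewrite !mul_scalar_mx !mxE !big_ord1 !mxE block_weightE -mulr_natr.
  by ring.
have gramV : V^T *m V = hub_gram qi.
  rewrite /V tr_row_mx mul_col_row /hub_gram.
  congr block_mx; apply/matrixP => i j; rewrite !ord1 !mxE.
  - rewrite -[RHS](sum_eql h); apply: eq_bigr => z _.
    by rewrite !mxE -natrM mulnb andbb.
  - by rewrite -[RHS](sum_eql h); apply: eq_bigr => z _; rewrite !mxE mulr1.
  - by rewrite -[RHS](sum_eql h); apply: eq_bigr => z _; rewrite !mxE mul1r.
  - under eq_bigr => z _ do rewrite !mxE mulr1.
    by rewrite sum_cst mulr1.
have := mxtrace_rank_update lam V (hub_form qi *m V^T) k.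
by rewrite -mulmxA gramV -/(quotient_mx qi) => /(canRL (subrK _)) ->; ring.
Qed.

End TransferMatrix.

(** * The chromatic polynomials *)

Lemma chromatic_poly_wheelE k :
  chromatic_poly (X_graph k.+1) = wheel_poly 'X k.+1.
Proof.
apply: chromatic_poly_unique (chromatic_polyP _) _ => q.
rewrite -[LHS]/(horner_eval q%:R _) rmorph_wheel_poly /= /horner_eval hornerX.
rewrite num_colourings_trace; under eq_bigr => h _ do rewrite mxtrace_block_weight.
by rewrite sum_cst.
Qed.

Local Ltac expand_coefficients :=
  rewrite /quotient_tr /quotient_det /generic_weight /lam /triple_gain
          /pair_gain /avoid_cube.

Theorem theorem3p1 :
  let q : {poly int} := 'X in
  let P (k : nat) : {poly int} := chromatic_poly (X_graph k) in
  let A : {poly int} :=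
    q^+5 - 9%:R * q^+4 + 37%:R * q^+3 - 88%:R * q^+2 + 127%:R * q - 94%:R in
  let B : {poly int} :=
    6%:R * q^+7 - 81%:R * q^+6 + 497%:R * q^+5 - 1781%:R * q^+4
    + 4026%:R * q^+3 - 5780%:R * q^+2 + 4968%:R * q - 2024%:R in
  let C : {poly int} :=
    (q - 1) ^+ 2 * (3%:R * q^+2 - 15%:R * q + 25%:R)
    * (3%:R * q^+5 - 33%:R * q^+4 + 157%:R * q^+3 - 399%:R * q^+2
       + 535%:R * q - 299%:R) in
  (forall k : nat, (1 <= k)%N ->
     P (k + 3)%N = A * (q - 2%:R) * P (k + 2)%N
                   + B * (q - 2%:R) ^+ 2 * P (k + 1)%N
                   + C * (q - 2%:R) ^+ 3 * P k)
  /\ P 1%N = q * (q - 1) ^+ 2 * (q - 2%:R)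
             * (q^+3 - 7%:R * q^+2 + 19%:R * q - 19%:R)
  /\ P 2%N = q * (q - 1) * (q - 2%:R) ^+ 2
             * (q^+9 - 17%:R * q^+8 + 138%:R * q^+7 - 692%:R * q^+6
                + 2353%:R * q^+5 - 5630%:R * q^+4 + 9525%:R * q^+3
                - 11086%:R * q^+2 + 8152%:R * q - 2913%:R)
  /\ P 3%N = q * (q - 1) * (q - 2%:R) ^+ 3
             * (q^+14 - 26%:R * q^+13 + 328%:R * q^+12 - 2645%:R * q^+11
                + 15181%:R * q^+10 - 65498%:R * q^+9 + 219032%:R * q^+8
                - 577468%:R * q^+7 + 1209533%:R * q^+6 - 2011958%:R * q^+5
                + 2633017%:R * q^+4 - 2650178%:R * q^+3 + 1957169%:R * q^+2
                - 957460%:R * q + 235366%:R).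
Proof.
move=> q P A B C.
have PE k : P k.+1 = wheel_poly q k.+1 by exact: chromatic_poly_wheelE.
split.
  case=> // k _; rewrite !addSn !PE addn3 addn2 addn1 wheel_poly_recurrence.
  have -> : quotient_tr q + lam q = A * (q - 2%:R).
    by rewrite /A; expand_coefficients; ring.
  have -> : quotient_det q + quotient_tr q * lam q = - (B * (q - 2%:R) ^+ 2).
    by rewrite /B; expand_coefficients; ring.
  have -> : quotient_det q * lam q = C * (q - 2%:R) ^+ 3.
    by rewrite /C; expand_coefficients; ring.
  by rewrite mulNr opprK.
rewrite !PE /wheel_poly !mxtrace_quotient_mxSS !expr1 expr0.
rewrite mxtrace_quotient_mx mxtrace1; expand_coefficients.
by split; [|split]; ring.
Qed.
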